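(* Let $g:\mathbb{R}^n\to\mathbb{R}$ be convex and $L_g$-smooth and $f(x)=\max_{(v,b)\in\mathcal V}\{v^\top x+b\}$ with $\mathcal V\subset\mathbb{R}^{n+1}$ finite and nonempty. Suppose the algorithms MPB-FA and Modified FCFW are started with $\mathcal V^0=\widehat{\mathcal V}^0$ and $x_0=\widehat x_0$ (and the same $\epsilon,\rho>0$). Then the iterates of MPB-FA can be chosen such that they exactly match the iterates of Modified FCFW, i.e. for every $k\ge0$: $\mathcal V^k=\widehat{\mathcal V}^k$, $x_k=\widehat x_k$, $y_{k+1}=\widehat y_{k+1}$, and the cuts can be chosen so that $(v_{k+1},b_{k+1})=(v^{FW}_{k+1},b^{FW}_{k+1})$; moreover the tests of the two algorithms are satisfied at the same iterations, so that they terminate at the same iterate.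
   Context: Let $g^*$ be the convex conjugate of $g$, $\phi(w)=g^*(-w)$, and for $\rho>0$ let $\mathcal M_{\rho,\phi}(w)=\inf_v\{\phi(v)+\frac1{2\rho}\|v-w\|^2\}$ be the Moreau envelope. $\min_x\{g(x)+f(x)\}$ is assumed to have an optimal solution. MPB-FA: inputs $x_0\in\mathbb{R}^n$, nonempty $\mathcal V^0\subset\mathcal V$, $\epsilon,\rho>0$. For $k=0,1,\dots$: let $f_k(x)=\max_{(v,b)\in\mathcal V^k}\{v^\top x+b\}$; $y_{k+1}$ solves $\min_x\{g(x)+f_k(x)+\frac\rho2\|x-x_k\|^2\}$; choose $(v_{k+1},b_{k+1})\in\arg\max_{(v,b)\in\mathcal V}\{v^\top y_{k+1}+b\}$; $\mathcal V^{k+1}=\mathcal V^k\cup\{(v_{k+1},b_{k+1})\}$; if $f(y_{k+1})-f_k(y_{k+1})\le\epsilon/2$ then $x_{k+1}=y_{k+1}$, else $x_{k+1}=x_k$. Modified FCFW: inputs $\widehat x_0\in\mathbb{R}^n$, nonempty $\widehat{\mathcal V}^0\subset\mathcal V$, $\epsilon,\rho>0$. For $k=0,1,\dots$: $(w_{k+1},\beta_{k+1})$ solves $\min_{(w,\beta)\in\mathrm{conv}(\widehat{\mathcal V}^k)}\{\mathcal M_{\rho,\phi}(w-\rho\widehat x_k)-\beta\}$; $\widehat y_{k+1}=-\nabla\mathcal M_{\rho,\phi}(w_{k+1}-\rho\widehat x_k)$; choose $(v^{FW}_{k+1},b^{FW}_{k+1})\in\arg\max_{(v,b)\in\mathcal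 V}\{v^\top\widehat y_{k+1}+b\}$; $\widehat{\mathcal V}^{k+1}=\widehat{\mathcal V}^k\cup\{(v^{FW}_{k+1},b^{FW}_{k+1})\}$; if $\langle\widehat y_{k+1},v^{FW}_{k+1}-w_{k+1}\rangle+b^{FW}_{k+1}-\beta_{k+1}\le\epsilon/2$ then $\widehat x_{k+1}=\widehat y_{k+1}$, else $\widehat x_{k+1}=\widehat x_k$. *)

(* Defs.v *)
From HB Require Import structures.
From mathcomp Require Export all_boot all_order all_algebra.
From mathcomp Require Export all_classical all_reals all_analysis.
Export numFieldNormedType.Exports.

Set Implicit Arguments.
Unset Strict Implicit.
Unset Printing Implicit Defensive.

Import Order.TTheory GRing.Theory Num.Theory.
Local Open Scope classical_set_scope.
Local Open Scope ring_scope.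

(* A cut (v, b) stands for the affine function x |-> <v, x> + b. The second
   component is R^o, rather than R, so that cuts form an R-module (needed by
   [convex_set]). *)
Notation cut R n := ('rV[R]_n * R^o)%type.

Section Euclidean.
Context {R : realType} {n : nat}.
Implicit Types u v x y : 'rV[R]_n.

Definition dotp u v : R := (u *m v^T) 0 0.

(* Not `|u|: the canonical norm on matrices is the sup norm. *)
Definition enorm u : R := Num.sqrt (dotp u u).

(* The vector of partial derivatives; total, like ['D_v f x]. *)
Definition grad (h : 'rV[R]_n -> R) x : 'rV[R]_n :=
  \row_i 'D_(delta_mx 0 i) h x.

Definition smooth (L : R) (h : 'rV[R]_n -> R) : Prop :=
  (forall x, differentiable h x) /\
  forall x y, enorm (grad h x - grad h y) <= L * enorm (x - y).

End Euclidean.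

Definition is_argmin {d} {T : porderType d} {X : Type}
    (D : set X) (F : X -> T) (x : X) : Prop :=
  D x /\ forall z, D z -> (F x <= F z)%O.

Definition is_argmax {d} {T : porderType d} {X : Type}
    (D : set X) (F : X -> T) (x : X) : Prop :=
  D x /\ forall z, D z -> (F z <= F x)%O.

Definition convex_hull {R : realType} {M : lmodType R} (A : set M) : set M :=
  smallest (@convex_set R M) A.

Section Functions.
Context {R : realType} {n : nat}.

Definition cut_eval (c : cut R n) (x : 'rV[R]_n) : R := dotp c.1 x + c.2.

(* Only used with W finite and nonempty, where the supremum is a maximum. *)
Definition cut_max (W : set (cut R n)) (x : 'rV[R]_n) : R :=
  sup [set cut_eval c x | c in W].

Definition conjugate (g : 'rV[R]_n -> R) (w : 'rV[R]_n) : \bar R :=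
  ereal_sup [set (dotp w x - g x)%:E | x in [set: 'rV[R]_n]].

Definition moreau (rho : R) (phi : 'rV[R]_n -> \bar R) (w : 'rV[R]_n) : \bar R :=
  ereal_inf [set (phi v + ((2 * rho)^-1 * enorm (v - w) ^+ 2)%:E)%E
            | v in [set: 'rV[R]_n]].

(* w |-> M_{rho,phi}(w) with phi(w) = g^*(-w) *)
Definition env (g : 'rV[R]_n -> R) (rho : R) : 'rV[R]_n -> \bar R :=
  moreau rho (fun w => conjugate g (- w)).

(* The Moreau envelope is extended-real valued by definition; its gradient is
   that of the associated real-valued function. *)
Definition grad_env (g : 'rV[R]_n -> R) (rho : R) (w : 'rV[R]_n) : 'rV[R]_n :=
  grad (fun u => fine (env g rho u)) w.

End Functions.

(* In the two algorithms, [x k] and [W k] are x_k and V^k, while [y k.+1],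
   [c k.+1], [p k.+1] are y_{k+1}, (v_{k+1}, b_{k+1}), (w_{k+1}, beta_{k+1});
   the values [y 0], [c 0], [p 0] are meaningless. *)
Section Algorithms.
Context {R : realType} {n : nat}.
Variables (g : 'rV[R]_n -> R) (V : set (cut R n)) (eps rho : R).

Definition mpb_test (W : nat -> set (cut R n)) (y : nat -> 'rV[R]_n)
    (k : nat) : bool :=
  cut_max V (y k.+1) - cut_max (W k) (y k.+1) <= eps / 2.

Definition mpb_run (x0 : 'rV[R]_n) (W0 : set (cut R n))
    (x y : nat -> 'rV[R]_n) (c : nat -> cut R n)
    (W : nat -> set (cut R n)) : Prop :=
  [/\ x 0%N = x0, W 0%N = W0 &
   forall k,
   [/\ is_argmin setT
         (fun z => g z + cut_max (W k) z + rho / 2 * enorm (z - x k) ^+ 2)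
         (y k.+1),
       is_argmax V (fun a => cut_eval a (y k.+1)) (c k.+1),
       W k.+1 = W k `|` [set c k.+1] &
       x k.+1 = if mpb_test W y k then y k.+1 else x k]].

Definition fcfw_test (y : nat -> 'rV[R]_n) (c p : nat -> cut R n)
    (k : nat) : bool :=
  dotp (y k.+1) ((c k.+1).1 - (p k.+1).1) + (c k.+1).2 - (p k.+1).2 <= eps / 2.

Definition fcfw_run (x0 : 'rV[R]_n) (W0 : set (cut R n))
    (x y : nat -> 'rV[R]_n) (c p : nat -> cut R n)
    (W : nat -> set (cut R n)) : Prop :=
  [/\ x 0%N = x0, W 0%N = W0 &
   forall k,
   [/\ is_argmin (convex_hull (W k))
         (fun q : cut R n => env g rho (q.1 - rho *: x k) - (q.2)%:E)%E
         (p k.+1),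
       y k.+1 = - grad_env g rho ((p k.+1).1 - rho *: x k),
       is_argmax V (fun a => cut_eval a (y k.+1)) (c k.+1),
       W k.+1 = W k `|` [set c k.+1] &
       x k.+1 = if fcfw_test y c p k then y k.+1 else x k]].

End Algorithms.

Section Termination.
Context {R : realType} {n : nat}.

Definition history (test : nat -> bool) (x : nat -> 'rV[R]_n) (k : nat) :
    seq (bool * 'rV[R]_n) :=
  [seq (test j, x j.+1) | j <- iota 0 k.+1].

(* The algorithm is stopped at the first iteration k at which the rule [stop],
   which sees all test outcomes and iterates so far, says so, and then outputs
   z = x_{k+1}. Stopping at the first satisfied test is the rule
   [fun h => has fst h]. *)
Definition terminates_at (stop : seq (bool * 'rV[R]_n) -> bool)
    (test : nat -> bool) (x : nat -> 'rV[R]_n) (k : nat) (z : 'rV[R]_n) : Prop :=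
  [/\ stop (history test x k),
      forall j, (j < k)%N -> ~~ stop (history test x j) &
      z = x k.+1].

End Termination.

(* Main.v *)
(** By Fenchel duality M_{rho,phi}(u) = - min_z (g z + <u,z> + rho/2 |z|^2), and
    strong convexity makes this minimum attained, at z(u) say, with the two-sided
    bound 0 <= M(u + d) - M(u) + <z(u),d> <= |d|^2 / (2 rho), so that
    grad M(u) = - z(u). Thus y_{k+1} = z(w_{k+1} - rho x_k) minimizes
    g + <w_{k+1},.> + rho/2 |. - x_k|^2. Optimality of (w_{k+1}, beta_{k+1}) in
    the hull of V^k makes it an affine minorant of f_k that is active at y_{k+1}:
    <w_{k+1},y_{k+1}> + beta_{k+1} = f_k(y_{k+1}). Therefore y_{k+1} also solves
    the proximal bundle subproblem, and the two tests compare the same number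
    with eps/2. *)
Require Import Defs.
From mathcomp Require Import ring lra.

Set Implicit Arguments.
Unset Strict Implicit.
Unset Printing Implicit Defensive.

Import Order.TTheory GRing.Theory Num.Theory.
Local Open Scope classical_set_scope.
Local Open Scope ring_scope.

(** * Real-number preliminaries *)

Lemma finite_set_has_ubound (R : realType) (A : set R) :
  finite_set A -> has_ubound A.
Proof.
move=> /finite_seqP[s ->]; exists (\sum_(a <- s) `|a|) => a /= a_s.
rewrite (big_rem a)//=; apply: (le_trans (ler_norm a)).
by rewrite lerDl sumr_ge0.
Qed.

Lemma le0_of_small_slope (R : realFieldType) (a b : R) :
  (forall t, 0 < t < 1 -> a <= t * b) -> a <= 0.
Proof.
move=> ab; rewrite leNgt; apply/negP => a0.
have d0 : 0 < a + `|b| + 1 by have := normr_ge0 b; lra.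
(* This [t] is below 1 and makes [t * b < a]. *)
have /ab : 0 < a / (a + `|b| + 1) < 1.
  by rewrite divr_gt0//= ltr_pdivrMr// mul1r; have := normr_ge0 b; lra.
rewrite mulrAC ler_pdivlMr// ler_pM2l// => ?.
by have := ler_norm b; lra.
Qed.

(** * Euclidean inner product versus the canonical sup norm *)

Section dotp.
Context {R : realType} {n : nat}.
Implicit Types u v w x y : 'rV[R]_n.

Lemma dotpE u v : dotp u v = \sum_i u 0 i * v 0 i.
Proof. by rewrite /dotp mxE; apply: eq_bigr => i _; rewrite mxE. Qed.

Lemma dotpC u v : dotp u v = dotp v u.
Proof. by rewrite !dotpE; apply: eq_bigr => i _; rewrite mulrC. Qed.

Lemma dotpDl u v w : dotp (u + v) w = dotp u w + dotp v w.
Proof. by rewrite /dotp mulmxDl mxE. Qed.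

Lemma dotpZl (a : R) u v : dotp (a *: u) v = a * dotp u v.
Proof. by rewrite /dotp -scalemxAl mxE. Qed.

Lemma dotpNl u v : dotp (- u) v = - dotp u v.
Proof. by rewrite -scaleN1r dotpZl mulN1r. Qed.

Lemma dotpDr u v w : dotp u (v + w) = dotp u v + dotp u w.
Proof. by rewrite dotpC dotpDl ![dotp _ u]dotpC. Qed.

Lemma dotpZr (a : R) u v : dotp u (a *: v) = a * dotp u v.
Proof. by rewrite dotpC dotpZl dotpC. Qed.

Lemma dotpNr u v : dotp u (- v) = - dotp u v.
Proof. by rewrite dotpC dotpNl dotpC. Qed.

Definition dotp_lin := (dotpDl, dotpDr, dotpZl, dotpZr, dotpNl, dotpNr).

Lemma dotp_ge0 u : 0 <= dotp u u.
Proof. by rewrite dotpE sumr_ge0// => i _; rewrite -expr2 sqr_ge0. Qed.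

Lemma enorm_sqr u : enorm u ^+ 2 = dotp u u.
Proof. by rewrite /enorm sqr_sqrtr// dotp_ge0. Qed.

(** The sup norm is attained at some coordinate, whose square is one term of the sum. *)
Lemma mx_norm_sqr_le_dotp u : `|u| ^+ 2 <= dotp u u.
Proof.
have [->|] := eqVneq `|u| 0; first by rewrite expr0n dotp_ge0.
move=> /(@mx_norm_neq0 R 1 n u)[[i j] /= nE].
rewrite /Num.norm/= nE ord1 real_normK ?num_real// dotpE (bigD1 j)//=.
by rewrite expr2 lerDl sumr_ge0// => k _; rewrite -expr2 sqr_ge0.
Qed.

Lemma continuous_dotp (f h : 'rV[R]_n -> 'rV[R]_n) :
  continuous f -> continuous h -> continuous (fun x => dotp (f x) (h x)).
Proof.
move=> cf ch.
have -> : (fun x => dotp (f x) (h x)) = fun x => \sum_i f x 0 i * h x 0 i.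
  by apply/funext => x; exact: dotpE.
have coord_comp (k : 'rV[R]_n -> 'rV[R]_n) i :
    continuous k -> continuous (fun x => k x 0 i).
  move=> ck x.
  apply: (@continuous_comp _ _ _ k (fun u : 'rV[R]_n => u 0 i)); first exact: ck.
  exact: coord_continuous.
apply: continuous_big => [|i _ x]; first exact: add_continuous.
exact: (cvgM (coord_comp f i cf x) (coord_comp h i ch x)).
Qed.

End dotp.

(** * Strong convexity and existence of minimizers *)

Section strong_convexity.
Context {R : realType} {n : nat}.
Variable rho : R.
Implicit Types (g G : 'rV[R]_n -> R) (u x y z : 'rV[R]_n).

Definition strongly_convex G := forall t x y, 0 < t < 1 ->
  G (t *: x + (1 - t) *: y) <=
    t * G x + (1 - t) * G y - rho / 2 * t * (1 - t) * dotp (x - y) (x - y).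

(** With [u = w - rho *: x], this is g + <w,.> + rho/2 |. - x|^2 up to a constant. *)
Definition tilted g u z : R := g z + dotp u z + rho / 2 * dotp z z.

Lemma convex_function_le g t x y : convex_function setT g -> 0 < t < 1 ->
  g (t *: x + (1 - t) *: y) <= t * g x + (1 - t) * g y.
Proof.
move=> cg /andP[/ltW t0 /ltW t1].
exact: (cg (Itv01 t0 t1) x y (in_setT _) (in_setT _)).
Qed.

Lemma tilted_strongly_convex g u :
  convex_function setT g -> strongly_convex (tilted g u).
Proof.
move=> cg t x y t01; have := convex_function_le x y cg t01.
by rewrite /tilted !dotp_lin (dotpC y x); lra.
Qed.

(** Compare [z] with [t *: x + (1 - t) *: z], divide by [t] and let [t] tend to 0. *)
Lemma strongly_convex_growth G z x : strongly_convex G ->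
  is_argmin setT G z -> G z + rho / 2 * dotp (x - z) (x - z) <= G x.
Proof.
move=> sG [_ zmin]; rewrite -subr_le0.
apply: (@le0_of_small_slope _ _ (rho / 2 * dotp (x - z) (x - z))) => t t01.
have := sG t x z t01; have := zmin (t *: x + (1 - t) *: z) I.
case/andP: t01 => t0 t1 h1 h2.
rewrite -(ler_pM2l t0); lra.
Qed.

Hypothesis rho_gt0 : 0 < rho.

(* Strong convexity on the segment from 0 to [z] propagates the lower bound of
   [G] on the unit ball to a growth of order [`|z| ^+ 2]. *)
Lemma strongly_convex_coercive G m z : strongly_convex G ->
  (forall x, `|x| <= 1 -> m <= G x) -> 1 < `|z| ->
  `|z| * (m - G 0 + rho / 2 * (`|z| - 1)) <= G z - G 0.
Proof.
move=> sG mG z1; set s := `|z| in z1 *.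
have s0 : 0 < s by apply: lt_trans z1.
have si : 0 < s^-1 < 1 by rewrite invr_gt0 s0 invf_lt1.
have := sG s^-1 z 0 si; rewrite scaler0 addr0 subr0 => Gz.
have /mG mz : `|s^-1 *: z| <= 1.
  by rewrite normrZ ger0_norm ?mulVf ?gt_eqF// invr_ge0 ltW.
have ds : s ^+ 2 <= dotp z z by exact: mx_norm_sqr_le_dotp.
have key : s^-1 * (s * (m - G 0 + rho / 2 * (s - 1))) <= s^-1 * (G z - G 0).
  rewrite mulKf ?gt_eqF//.
  have : rho / 2 * (s - 1) <= rho / 2 * s^-1 * (1 - s^-1) * dotp z z.
    have -> : rho / 2 * (s - 1) = rho / 2 * s^-1 * (1 - s^-1) * s ^+ 2.
      by field; rewrite gt_eqF.
    apply: ler_wpM2l ds; case/andP: si => si0 si1.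
    apply: mulr_ge0; last by rewrite subr_ge0 ltW.
    by apply: mulr_ge0; [rewrite divr_ge0// ltW|exact: ltW].
  lra.
by move: key; rewrite ler_pM2l// invr_gt0.
Qed.

Lemma strongly_convex_argmin G : continuous G -> strongly_convex G ->
  exists z, is_argmin setT G z.
Proof.
move=> cG sG.
have ball_argmin (r : R) : 0 <= r ->
    exists2 z, `|z| <= r & forall x, `|x| <= r -> G z <= G x.
  move=> r0; have cB : compact [set x : 'rV[R]_n | `|x| <= r].
    apply: bounded_closed_compact.
      by exists r; split => [|M rM x /= xr]; [exact: num_real|lra].
    apply: (@closed_comp _ _ (fun x : 'rV[R]_n => `|x|) [set y | y <= r]).
      by move=> x _; exact: norm_continuous.
    exact: closed_le.
  have B0 : [set x : 'rV[R]_n | `|x| <= r] !=set0 by exists 0; rewrite /= normr0.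
  have [z /set_mem/= zr zmin] := EVT_min_rV B0 cB (continuous_subspaceT cG).
  by exists z => // x xr; apply: zmin; apply/mem_set.
have [z1 _ min1] := ball_argmin 1 ler01.
have z10 : G z1 <= G 0 by apply: min1; rewrite normr0.
(* Beyond this radius the lower bound of [strongly_convex_coercive], with [m = G z1], is
   nonnegative. *)
pose r := 1 + 2 * (G 0 - G z1) / rho.
have r1 : 1 <= r by rewrite lerDl; apply: divr_ge0; [lra|exact: ltW].
have [z _ zmin] := ball_argmin r (le_trans ler01 r1).
exists z; split=> // x _; have [/zmin//|xr] := leP `|x| r.
have z0 : G z <= G 0 by apply: zmin; rewrite normr0; lra.
apply: (le_trans z0); rewrite -subr_ge0.
apply: le_trans (strongly_convex_coercive sG min1 (le_lt_trans r1 xr)).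
apply: mulr_ge0 => //.
have : 2 * (G 0 - G z1) / rho * rho <= (`|x| - 1) * rho.
  by rewrite ler_pM2r//; move: xr; rewrite /r; lra.
by rewrite divfK ?gt_eqF//; lra.
Qed.

Lemma tilted_argmin g u : convex_function setT g -> continuous g ->
  exists z, is_argmin setT (tilted g u) z.
Proof.
move=> cvg_g cg; apply: strongly_convex_argmin; last exact: tilted_strongly_convex.
have cu : continuous (fun z => dotp u z).
  apply: (@continuous_dotp _ _ (cst u) id) => y; last exact: cvg_id.
  exact: cst_continuous.
have cz : continuous (fun z : 'rV[R]_n => dotp z z).
  by apply: (@continuous_dotp _ _ id id) => y; exact: cvg_id.
move=> x; exact: cvgD (cvgD (cg x) (cu x)) (cvgM (cvg_cst (rho / 2)) (cz x)).
Qed.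

End strong_convexity.

(** The difference quotient is within [C * |h|] of [l], so the derivative is identified without
    assuming differentiability. *)
Lemma derive_quadratic_error (R : realType) (V : normedModType R)
    (G : V -> R) (a v : V) (l C : R) :
  (forall h, `|G (h *: v + a) - G a - h * l| <= C * h ^+ 2) -> 'D_v G a = l.
Proof.
move=> GC; apply: cvg_lim => //; apply/cvgrPdist_le => e e0.
have C0 : 0 <= C by have := GC 1; rewrite expr1n mulr1; apply: le_trans.
have C1 : 0 < C + 1 by lra.
near=> h.
have h0 : h != 0 by near: h; exact: nbhs_dnbhs_neq.
(* [C + 1] replaces [C], which may vanish. *)
have he : `|h| <= e / (C + 1).
  near: h; apply: nbhs_dnbhs; apply: (@nbhs0_le _ R^o).
  exact: divr_gt0.
have -> : l - h^-1 *: (G (h *: v + a) - G a)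
    = - (h^-1 * (G (h *: v + a) - G a - h * l)).
  by rewrite /GRing.scale/=; field.
rewrite normrN normrM normfV ler_pdivrMl ?normr_gt0//.
apply: (le_trans (GC h)); rewrite -real_normK ?num_real// expr2 mulrCA.
rewrite ler_pM2l ?normr_gt0//.
move: he; rewrite ler_pdivlMr// => he.
by have := normr_ge0 h; lra.
Unshelve. all: by end_near. Qed.

(** * Value and gradient of the Moreau envelope *)

Section moreau_envelope.
Context {R : realType} {n : nat}.
Variables (g : 'rV[R]_n -> R) (rho : R).
Hypotheses (g_convex : convex_function setT g) (g_cont : continuous g).
Hypothesis rho_gt0 : 0 < rho.
Implicit Types (u v d x z : 'rV[R]_n).

(** Expand |u - rho v|^2 >= 0. *)
Lemma dotp_young u v :
  dotp u v <= (2 * rho)^-1 * dotp u u + rho / 2 * dotp v v.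
Proof.
have rho2 : 0 <= (2 * rho)^-1.
  by rewrite invr_ge0; apply: mulr_ge0; [exact: ler0n|exact: ltW].
have := mulr_ge0 rho2 (dotp_ge0 (u - rho *: v)).
have -> : (2 * rho)^-1 * dotp (u - rho *: v) (u - rho *: v) =
    (2 * rho)^-1 * dotp u u - dotp u v + rho / 2 * dotp v v.
  by rewrite !dotp_lin (dotpC v u); field; rewrite gt_eqF.
lra.
Qed.

(* The infimum over [v] is attained at [u + rho *: z], the negative of a
   subgradient of [g] at [z], where Fenchel's inequality is an equality. *)
Lemma envE u z : is_argmin setT (tilted rho g u) z ->
  env g rho u = (- tilted rho g u z)%:E.
Proof.
move=> zmin; apply/eqP; rewrite eq_le; apply/andP; split.
- apply: (@le_trans _ _ (conjugate g (- (u + rho *: z)) +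
    ((2 * rho)^-1 * enorm (u + rho *: z - u) ^+ 2)%:E)%E).
    by apply: ereal_inf_lbound; exists (u + rho *: z).
  have : (conjugate g (- (u + rho *: z)) <=
      (- dotp (u + rho *: z) z - g z)%:E)%E.
    apply: ge_ereal_sup => _ [x _ <-]; rewrite lee_fin.
    (* The growth term cancels |x|^2 exactly, leaving the subgradient inequality of [g] at [z]. *)
    have := strongly_convex_growth x (tilted_strongly_convex rho u g_convex) zmin.
    by rewrite /tilted !dotp_lin (dotpC z x); lra.
  move=> /(leeD2r ((2 * rho)^-1 * enorm (u + rho *: z - u) ^+ 2)%:E).
  move=> /le_trans; apply; rewrite -EFinD lee_fin enorm_sqr (addrC u) addrK.
  rewrite /tilted !dotp_lin le_eqVlt; apply/orP; left; apply/eqP.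
  by field; rewrite gt_eqF.
(* Conversely, bound the conjugate below by its term at [z] and apply Young's inequality to <v - u,
   z>. *)
- apply: le_ereal_inf_tmp => _ [v _ <-].
  apply: (@le_trans _ _ ((dotp (- v) z - g z)%:E +
    ((2 * rho)^-1 * enorm (v - u) ^+ 2)%:E)%E); last first.
    by apply: leeD2r; apply: ereal_sup_ubound; exists z.
  rewrite -EFinD lee_fin enorm_sqr.
  have := dotp_young (v - u) z.
  by rewrite /tilted [dotp (v - u) z]dotpDl !dotpNl; lra.
Qed.

(** Lower bound: test the perturbed problem at the old minimizer [z]. Upper bound: the growth of the
    old objective at the new minimizer [y] absorbs the term rho/2 |z - y|^2 that Young's inequality
    produces from <d, z - y>. *)
Lemma env_perturb u z d : is_argmin setT (tilted rho g u) z ->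
  exists e, [/\ env g rho (u + d) = e%:E,
    - tilted rho g u z - dotp z d <= e &
    e <= - tilted rho g u z - dotp z d + (2 * rho)^-1 * dotp d d].
Proof.
move=> zmin.
have [y ymin] := tilted_argmin rho_gt0 (u + d) g_convex g_cont.
exists (- tilted rho g (u + d) y); split; first exact: envE.
  have := ymin.2 z I; rewrite /tilted !dotp_lin (dotpC z d); lra.
have := strongly_convex_growth y (tilted_strongly_convex rho u g_convex) zmin.
have := dotp_young d (z - y).
rewrite -(opprB y z) [dotp (- _) (- _)]dotpNl !dotpNr opprK.
rewrite /tilted (dotpDr d) dotpNr (dotpDl u) (dotpC z d).
lra.
Qed.

Lemma grad_envE u z : is_argmin setT (tilted rho g u) z ->
  grad_env g rho u = - z.
Proof.
move=> zmin; apply/rowP => i; rewrite !mxE.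
apply: (@derive_quadratic_error _ _ _ _ _ _
  ((2 * rho)^-1 * dotp (delta_mx 0 i) (delta_mx 0 i))) => h.
rewrite (envE zmin)/= [_ *: _ + u]addrC.
have [e [-> lo hi]] := env_perturb (h *: delta_mx 0 i) zmin; rewrite /=.
have zi : dotp z (delta_mx 0 i) = z 0 i.
  rewrite dotpE (bigD1 i)//= big1 ?addr0 ?mxE ?eqxx ?mulr1// => j ji.
  by rewrite mxE (negbTE ji) andbF mulr0.
move: lo hi; rewrite !dotp_lin zi => lo hi.
rewrite ger0_norm; lra.
Qed.

End moreau_envelope.

(** * Cuts and their convex hull *)

Section cuts.
Context {R : realType} {n : nat}.
Implicit Types (W : set (cut R n)) (z : 'rV[R]_n) (p q : cut R n).

Lemma cut_max_ub W z q : finite_set W -> W q -> cut_eval q z <= cut_max W z.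
Proof.
move=> Wfin Wq; apply: ub_le_sup; last by exists q.
exact/finite_set_has_ubound/finite_image.
Qed.

Lemma cut_max_argmax W z q :
  is_argmax W (fun a => cut_eval a z) q -> cut_max W z = cut_eval q z.
Proof.
move=> [Wq qmax]; apply/eqP; rewrite eq_le; apply/andP; split.
  by apply: ge_sup => [|_ [a Wa <-]]; [exists (cut_eval q z), q|exact: qmax].
by apply: ub_le_sup; [exists (cut_eval q z) => _ [a Wa <-]; exact: qmax|exists q].
Qed.

Lemma cut_eval_conv p q z (t : R) :
  cut_eval (t *: p + (1 - t) *: q) z = t * cut_eval p z + (1 - t) * cut_eval q z.
Proof.
by rewrite /cut_eval/= !dotp_lin /GRing.scale/=; ring.
Qed.

(** For fixed [z] the cuts satisfying the bound form a convex set containing [W]. *)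
Lemma convex_hull_cut_le W z p : finite_set W -> convex_hull W p ->
  cut_eval p z <= cut_max W z.
Proof.
move=> Wfin; suff /smallest_sub :
    @convex_set R (cut R n) [set q | cut_eval q z <= cut_max W z].
  by apply; move=> q Wq; exact: cut_max_ub.
move=> a b t /set_mem/= az /set_mem/= bz; apply/mem_set => /=.
have t0 : 0 <= t%:num by exact: ge0.
have t1 : 0 <= 1 - t%:num by rewrite subr_ge0; exact: le1.
apply: (@le_trans _ _ (t%:num * cut_eval a z + (1 - t%:num) * cut_eval b z)).
  by rewrite -cut_eval_conv.
by have := ler_wpM2l t0 az; have := ler_wpM2l t1 bz; lra.
Qed.

Lemma convex_hull_segment W p q (t : R) : convex_hull W p -> W q -> 0 < t < 1 ->
  convex_hull W (t *: q + (1 - t) *: p).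
Proof.
move=> Wp Wq /andP[/ltW t0 /ltW t1] A [cA WA]; apply/set_mem.
apply: (cA q p (Itv01 t0 t1)); apply/mem_set; first exact: WA.
exact: Wp.
Qed.

End cuts.

(** * One step of Modified FCFW solves the bundle subproblem *)

Section fcfw_step.
Context {R : realType} {n : nat}.
Variables (g : 'rV[R]_n -> R) (rho : R) (x : 'rV[R]_n) (W : set (cut R n)).
Hypotheses (g_convex : convex_function setT g) (g_cont : continuous g).
Hypotheses (rho_gt0 : 0 < rho) (W_finite : finite_set W) (W_neq0 : W !=set0).
Variable p : cut R n.
Hypothesis p_argmin : is_argmin (convex_hull W)
  (fun q : cut R n => env g rho (q.1 - rho *: x) - (q.2)%:E)%E p.
Let y := - grad_env g rho (p.1 - rho *: x).

Lemma fcfw_step_argmin : is_argmin setT (tilted rho g (p.1 - rho *: x)) y.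
Proof.
have [z zmin] := tilted_argmin rho_gt0 (p.1 - rho *: x) g_convex g_cont.
by rewrite /y (grad_envE g_convex g_cont rho_gt0 zmin) opprK.
Qed.

(* First-order optimality of [p] towards each cut of [W]. *)
Lemma fcfw_step_cut_max : cut_max W y = cut_eval p y.
Proof.
apply/eqP; rewrite eq_le; apply/andP; split; last first.
  exact: convex_hull_cut_le p_argmin.1.
have ymin := fcfw_step_argmin.
apply: ge_sup; first by case: W_neq0 => q Wq; exists (cut_eval q y), q.
move=> _ [q Wq <-]; rewrite -subr_le0.
(* The constant comes from the error of [env_perturb] for the shift [t *: (q.1 - p.1)]; that error
   is of order [t ^+ 2], hence still of order [t] after division by [t]. *)
apply: (@le0_of_small_slope _ _ ((2 * rho)^-1 * dotp (q.1 - p.1) (q.1 - p.1))) => t t01.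
have := p_argmin.2 _ (convex_hull_segment p_argmin.1 Wq t01).
have -> : (t *: q + (1 - t) *: p).1 - rho *: x =
    (p.1 - rho *: x) + t *: (q.1 - p.1).
  rewrite /= scalerBr scalerBl scale1r [RHS]addrAC; congr (_ - _).
  by rewrite [RHS]addrCA addrA.
rewrite (envE g_convex rho_gt0 ymin).
have [e [-> _ hi]] := env_perturb g_convex g_cont rho_gt0 (t *: (q.1 - p.1)) ymin.
rewrite -!EFinB lee_fin /= => opt.
case/andP: t01 => t0 t1; rewrite -(ler_pM2l t0) /cut_eval.
move: hi; rewrite dotpZr dotpZl dotpZr dotpDr dotpNr !(dotpC _ y).
by move: opt; rewrite /GRing.scale/=; lra.
Qed.

Lemma fcfw_step_bundle : is_argmin setT
  (fun z => g z + cut_max W z + rho / 2 * enorm (z - x) ^+ 2) y.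
Proof.
split=> // z _; rewrite !enorm_sqr fcfw_step_cut_max.
have := convex_hull_cut_le z W_finite p_argmin.1.
(* Completing the square turns this into minimality of [y] for the proximal objective with [p] as
   model. *)
have := fcfw_step_argmin.2 z I.
by rewrite /tilted /cut_eval !dotp_lin !(dotpC _ x); lra.
Qed.

End fcfw_step.

(** * Comparison of the two runs *)

Lemma fcfw_run_subset (R : realType) (n : nat) (g : 'rV[R]_n -> R)
    (V : set (cut R n)) (eps rho : R) x0 V0 x y c p W :
  V0 `<=` V -> fcfw_run g V eps rho x0 V0 x y c p W ->
  forall k, V0 `<=` W k /\ W k `<=` V.
Proof.
move=> V0V [_ W0 step]; elim=> [|k [V0W WV]]; first by rewrite W0; split.
have [_ _ [Vc _] WS _] := step k; rewrite WS; split=> q; first by move=> /V0W; left.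
by case=> [/WV|->].
Qed.

Lemma fcfw_testE (R : realType) (n : nat) (V W : set (cut R n)) (y : 'rV[R]_n)
    (c p : cut R n) :
  is_argmax V (fun a => cut_eval a y) c -> cut_max W y = cut_eval p y ->
  cut_max V y - cut_max W y = dotp y (c.1 - p.1) + c.2 - p.2.
Proof.
move=> /cut_max_argmax -> ->; rewrite /cut_eval dotpDr dotpNr !(dotpC _ y).
lra.
Qed.

Theorem proposition3p7 (R : realType) (n : nat)
    (g : 'rV[R]_n -> R) (L : R) (V : set (cut R n))
    (g_convex : convex_function setT g) (g_smooth : smooth L g)
    (V_finite : finite_set V) (V_nonempty : V !=set0)
    (opt : exists xs, is_argmin setT (fun x => g x + cut_max V x) xs)
    (eps rho : R) (eps_gt0 : 0 < eps) (rho_gt0 : 0 < rho)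
    (x0 : 'rV[R]_n) (V0 : set (cut R n))
    (V0_nonempty : V0 !=set0) (V0_sub : V0 `<=` V)
    (xh yh : nat -> 'rV[R]_n) (ch ph : nat -> cut R n)
    (Vh : nat -> set (cut R n))
    (fcfw : fcfw_run g V eps rho x0 V0 xh yh ch ph Vh) :
  exists (x y : nat -> 'rV[R]_n) (c : nat -> cut R n)
         (W : nat -> set (cut R n)),
    [/\ mpb_run g V eps rho x0 V0 x y c W,
        forall k, [/\ W k = Vh k, x k = xh k, y k.+1 = yh k.+1 &
                      c k.+1 = ch k.+1],
        forall k, mpb_test V eps W y k = fcfw_test eps yh ch ph k &
        forall stop k z,
          terminates_at stop (mpb_test V eps W y) x k z <->
          terminates_at stop (fcfw_test eps yh ch ph) xh k z].
Proof.
have g_cont : continuous g by move=> x; exact: differentiable_continuous (g_smooth.1 x).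
have Vh_sub := fcfw_run_subset V0_sub fcfw.
have Vh_finite k : finite_set (Vh k) := sub_finite_set (Vh_sub k).2 V_finite.
have Vh_neq0 k : Vh k !=set0 := subset_nonempty (Vh_sub k).1 V0_nonempty.
have [xh0 Vh0 step] := fcfw.
(* Equality as functions makes the histories seen by any stopping rule identical. *)
have testE : mpb_test V eps Vh yh = fcfw_test eps yh ch ph.
  apply/funext => k; have [pk yk ck _ _] := step k.
  have := fcfw_step_cut_max g_convex g_cont rho_gt0 (Vh_finite k) (Vh_neq0 k) pk.
  by rewrite -yk => /(fcfw_testE ck) ckE; rewrite /mpb_test ckE.
(* The iterates of Modified FCFW themselves serve as the MPB-FA run. *)
exists xh, yh, ch, Vh; rewrite testE; split=> //; split=> // k.
have [pk yk ck Wk xk] := step k; split=> //; last by rewrite testE.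
have := fcfw_step_bundle g_convex g_cont rho_gt0 (Vh_finite k) (Vh_neq0 k) pk.
by rewrite -yk.
Qed.
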